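(* Let $i\in\mathcal I_D$, $l\in\mathcal I_E$, $\tau\ge0$, $\gamma\ge0$, let the asymptotes $L,U$ satisfy the requirements given in the context, and let $\psi_l$ be a polynomial parametrization of order $k$. Let $p^i_l$ and $q^i_l$ be the polynomials defined in the context, for which $f^{i,\tau}_{\bar{\boldsymbol B},R}(\operatorname{Re}\psi_l(\delta))+f^{i,\tau}_{\bar{\boldsymbol B},I}(\operatorname{Im}\psi_l(\delta))=p^i_l(\delta)/q^i_l(\delta)$ on $[0,1]$. Consider the following procedure: 1. Find the real roots $\alpha^{(1)},\dots,\alpha^{(n)}$ in $(0,1)$ of the polynomial $$q^i_l(\delta)\,(p^i_l)'(\delta)-(q^i_l)'(\delta)\,p^i_l(\delta)+\gamma(1-2\delta)\,q^i_l(\delta)^2$$ (with $n=0$ if this polynomial vanishes identically). 2. Set $(\beta_1,\dots,\beta_{n+2})=(0,\alpha^{(1)},\dots,\alpha^{(n)},1)$ and, for $1\le m\le n+2$, $j_m=f^{i,\tau}_{\bar{\boldsymbol B},R}(\operatorname{Re}\psi_l(\beta_m))+f^{i,\tau}_{\bar{\boldsymbol B},I}(\operatorname{Im}\psi_l(\beta_m))+\gamma\beta_m(1-\beta_m)$. 3. Choose $n^*$ with $j_{n^*}\le j_m$ for all $1\le m\le n+2$ and set $\alpha^*_l=\beta_{n^*}$. Then $\alpha_l^*$ is a global optimal solution of $$\min_{\alpha\in[0,1]}\ f^{i,\tau}_{\bar{\boldsymbol B},R}(\operatorname{Re}\psi_l(\alpha))+f^{i,\tau}_{\bar{\boldsymbol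 B},I}(\operatorname{Im}\psi_l(\alpha))+\gamma\alpha(1-\alpha).$$
   Context: Notation. $\mathbb S_{\mathbb C}$, $\mathbb S_{\mathbb R}$: symmetric $2\times2$ complex, real matrices; $\langle A,B\rangle=\operatorname{Re}(\operatorname{tr}(A^HB))$; $Y^R=\operatorname{Re}Y$, $Y^I=\operatorname{Im}Y$ entrywise; $\mathbb 1$ is the identity matrix; $\operatorname{adj}$ is the adjugate. Admissible set. $(V,E)$ is a finite graph with edges $e_1,\dots,e_{N_E}$, $\mathcal I_E=\{1,\dots,N_E\}$; every vertex lies on at least one edge and carries a tensor in $\mathbb S_{\mathbb C}$. A parametrization is a map $\psi:\mathcal I_E\times[0,1]\to\mathbb S_{\mathbb C}$, $\psi_l=\psi(l,\cdot)$, twice continuously differentiable in the second variable, with $\psi_l(0),\psi_l(1)$ the tensors at the first and second node of $e_l$, and injective on $\mathcal I_E\times(0,1)$. $\mathcal G=\bigcup_l\psi_l([0,1])$, $\mathcal I_D=\{1,\dots,K\}$, $\mathcal B=\mathcal G^K$. Polynomial parametrization of order $k$: $\psi_l(\delta)=B^{(1)}(1-\delta)+B^{(2)}\delta+\delta(1-\delta)\sum_{m=0}^{k-2}A_m\delta^m$, $\delta\in[0,1]$, with $B^{(1)},B^{(2)},A_m\in\mathbb S_{\mathbb C}$. Approximation terms. $f:\mathbb S_{\mathbb C}^K\to\mathbb R$ is continuously differentiable on $\mathcal B$ and $\bar{\boldsymbol B}=(\bar B_1,\dots,\bar B_K)\in\mathcal B$ is a fixed expansion point. $\nabla^{i,R}f(\bar{\boldsymbol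 B}),\nabla^{i,I}f(\bar{\boldsymbol B})\in\mathbb S_{\mathbb R}$ are defined by $\frac{\partial f(\bar{\boldsymbol B})}{\partial\boldsymbol B}[\boldsymbol Y]=\sum_{i=1}^K\langle\nabla^{i,R}f(\bar{\boldsymbol B}),(\boldsymbol Y)_i^R\rangle+\langle\nabla^{i,I}f(\bar{\boldsymbol B}),(\boldsymbol Y)_i^I\rangle$, and $\nabla^{i,s}_\pm f(\bar{\boldsymbol B})$ are their projections onto the symmetric positive (+) and negative (−) semidefinite matrices. Asymptotes $L=l_0\mathbb 1$, $U=u_0\mathbb 1$ ($l_0,u_0\in\mathbb C$) satisfy $L^s\prec Y^s\prec U^s$ for all $Y\in\mathcal G$, $s\in\{R,I\}$. For $s\in\{R,I\}$ put $$C^{i,s}_U=(U^s-\bar B_i^s)\nabla^{i,s}_+f(\bar{\boldsymbol B})(U^s-\bar B_i^s),\qquad C^{i,s}_L=(L^s-\bar B_i^s)\nabla^{i,s}_-f(\bar{\boldsymbol B})(L^s-\bar B_i^s),$$ $$f^{i,\tau}_{\bar{\boldsymbol B},s}(Y)=\langle C^{i,s}_U+\tau(Y-\bar B_i^s)^2,(U^s-Y)^{-1}\rangle+\langle C^{i,s}_L-\tau(Y-\bar B_i^s)^2,(L^s-Y)^{-1}\rangle.$$ The polynomials. With $Y=\psi_l(\delta)$, $N^{i,s}_L(\delta)=\langle C^{i,s}_L-\tau(Y^s-\bar B^s_i)^2,\operatorname{adj}(L^s-Y^s)\rangle$, $N^{i,s}_U(\delta)=\langle C^{i,s}_U+\tau(Y^s-\bar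 B^s_i)^2,\operatorname{adj}(U^s-Y^s)\rangle$: $$q^i_l(\delta)=\prod_{s\in\{R,I\}}\det(L^s-Y^s)\det(U^s-Y^s),\qquad p^i_l(\delta)=\sum_{s\in\{R,I\}}\frac{N^{i,s}_L(\delta)q^i_l(\delta)}{\det(L^s-Y^s)}+\frac{N^{i,s}_U(\delta)q^i_l(\delta)}{\det(U^s-Y^s)}.$$ *)

(* Defs.v *)
From HB Require Import structures.
From mathcomp Require Import all_boot all_order all_algebra.
From mathcomp Require Import complex.
From mathcomp Require Import all_classical all_reals all_analysis.

Set Implicit Arguments.
Unset Strict Implicit.
Unset Printing Implicit Defensive.

Import Order.TTheory GRing.Theory Num.Theory.
Import numFieldNormedType.Exports.

Local Open Scope classical_set_scope.
Local Open Scope ring_scope.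

Variant part := RePart | ImPart.

Definition cpart (R : Type) (s : part) (z : complex R) : R :=
  match s with RePart => complex.Re z | ImPart => complex.Im z end.

Definition mxpart (R : Type) (m n : nat) (s : part) (A : 'M[complex R]_(m, n)) :
  'M[R]_(m, n) := map_mx (cpart s) A.

Lemma cpartD (R : realType) (s : part) : {morph @cpart R s : x y / x + y}.
Proof. by case: s => -[a b] [c d]. Qed.

Lemma cpartZ (R : realType) (s : part) (a : R) (z : complex R) :
  cpart s (real_complex R a * z) = a * cpart s z.
Proof. by case: s z => -[x y]; rewrite /= mul0r ?subr0 ?addr0. Qed.

Lemma mxpartD (R : realType) (s : part) :
  {morph @mxpart R 2 2 s : A B / A + B}.
Proof. by move=> A B; apply/matrixP => i j; rewrite !mxE cpartD. Qed.

Lemma mxpartZ (R : realType) (s : part) (a : R) (A : 'M[complex R]_2) :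
  mxpart s (real_complex R a *: A) = a *: mxpart s A.
Proof. by apply/matrixP => i j; rewrite !mxE cpartZ. Qed.

Definition symmx (F : nzRingType) : {pred 'M[F]_2} := [pred A : 'M[F]_2 | A^T == A].

Lemma symmx_zmod (F : nzRingType) : zmod_closed (@symmx F).
Proof.
split=> [|A B]; rewrite !inE ?trmx0 // => /eqP hA /eqP hB.
by rewrite linearB /= hA hB.
Qed.

HB.instance Definition _ (F : nzRingType) :=
  GRing.isZmodClosed.Build 'M[F]_2 (@symmx F) (@symmx_zmod F).

Record symC (R : realType) := SymC {
  symC_val :> 'M[complex R]_2;
  symC_valP : symC_val \in @symmx (complex R)
}.

HB.instance Definition _ (R : realType) := [isSub for @symC_val R].
HB.instance Definition _ (R : realType) := [Choice of symC R by <:].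
HB.instance Definition _ (R : realType) :=
  [SubChoice_isSubZmodule of symC R by <:].

Section SymCNormed.
Variable R : realType.
Implicit Types (a b : R) (A B : symC R).

Lemma symC_scale_subproof a A :
  real_complex R a *: symC_val A \in @symmx (complex R).
Proof. by have := symC_valP A; rewrite !inE linearZ /= => /eqP ->. Qed.

Definition symC_scale a A : symC R := SymC (symC_scale_subproof a A).

Lemma symC_scaleA a b A :
  symC_scale a (symC_scale b A) = symC_scale (a * b) A.
Proof. by apply: val_inj; rewrite /= scalerA rmorphM. Qed.

Lemma symC_scale1 : left_id 1 symC_scale.
Proof. by move=> A; apply: val_inj; rewrite /= scale1r. Qed.

Lemma symC_scaleDr : right_distributive symC_scale +%R.
Proof. by move=> a A B; apply: val_inj; rewrite /= scalerDr. Qed.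

Lemma symC_scaleDl A : {morph symC_scale^~ A : a b / a + b}.
Proof. by move=> a b; apply: val_inj; rewrite /= rmorphD scalerDl. Qed.

HB.instance Definition _ := GRing.Zmodule_isLmodule.Build R (symC R)
  symC_scaleA symC_scale1 symC_scaleDr symC_scaleDl.

(* symC is finite dimensional over R, so this norm induces the same topology and
   the same derivatives as the Frobenius norm; likewise symCn_norm below. *)
Definition symC_norm A : R := `|mxpart RePart A| + `|mxpart ImPart A|.

Lemma symC_norm_leD A B : symC_norm (A + B) <= symC_norm A + symC_norm B.
Proof.
rewrite /symC_norm /= !mxpartD addrACA.
by apply: lerD; exact: ler_normD.
Qed.

Lemma symC_normZ a A : symC_norm (a *: A) = `|a| * symC_norm A.
Proof. by rewrite /symC_norm /= !mxpartZ !normrZ mulrDr. Qed.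

Lemma symC_norm_eq0 A : symC_norm A = 0 -> A = 0.
Proof.
move/eqP; rewrite /symC_norm paddr_eq0 // !normr_eq0.
move=> /andP[/eqP/matrixP hr /eqP/matrixP hi]; apply: val_inj.
apply/matrixP => i j; move: (hr i j) (hi i j); rewrite !mxE.
by case: (symC_val A i j) => x y /= -> ->.
Qed.

HB.instance Definition _ := Lmodule_isNormed.Build R (symC R)
  symC_norm_leD symC_normZ symC_norm_eq0.

End SymCNormed.

Definition symCn (R : realType) (K : nat) : Type := {ffun 'I_K -> symC R}.

HB.instance Definition _ (R : realType) (K : nat) :=
  GRing.Lmodule.copy (symCn R K) {ffun 'I_K -> symC R}.

Definition symCn_fun (R : realType) (K : nat) (X : symCn R K) :
  {ffun 'I_K -> symC R} := X.
Coercion symCn_fun : symCn >-> finfun_of.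

Section SymCnNormed.
Variables (R : realType) (K : nat).
Implicit Types X Y : symCn R K.

Definition symCn_norm X : R := \sum_(i < K) `|X i|.

Lemma symCn_norm_leD X Y : symCn_norm (X + Y) <= symCn_norm X + symCn_norm Y.
Proof.
rewrite /symCn_norm -big_split /=; apply: ler_sum => i _.
by rewrite ffunE; exact: ler_normD.
Qed.

Lemma symCn_normZ (a : R) X : symCn_norm (a *: X) = `|a| * symCn_norm X.
Proof.
rewrite /symCn_norm mulr_sumr; apply: eq_bigr => i _.
by rewrite ffunE normrZ.
Qed.

Lemma symCn_norm_eq0 X : symCn_norm X = 0 -> X = 0.
Proof.
move=> /eqP; rewrite psumr_eq0 // => /allP h; apply/ffunP => i.
by have := h i (mem_index_enum i); rewrite normr_eq0 ffunE => /eqP.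
Qed.

HB.instance Definition _ := Lmodule_isNormed.Build R (symCn R K)
  symCn_norm_leD symCn_normZ symCn_norm_eq0.

End SymCnNormed.

(* Curves psi l : [0, 1] -> S_C are represented by total functions on R; every
   condition below only involves their values on [0, 1]. *)

(* Derivative relative to [0, 1]: one-sided at the end points *)
Definition derivative01 (R : realType) (W : normedModType R)
    (g : R -> W) (x : R) (d : W) : Prop :=
  (y - x)^-1 *: (g y - g x) @[y --> within (`[0, 1] `\ x) (nbhs x)] --> d.

Definition C2_on01 (R : realType) (W : normedModType R) (g : R -> W) : Prop :=
  exists g1 g2 : R -> W,
    [/\ forall x, x \in `[0, 1] -> derivative01 g x (g1 x),
        forall x, x \in `[0, 1] -> derivative01 g1 x (g2 x)
      & {within `[0, 1], continuous g2}].

Record parametrization (R : realType) (V : finType) (NE : nat)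
    (edge : 'I_NE -> V * V) (tensor : V -> symC R)
    (psi : 'I_NE -> R -> symC R) : Prop := {
  param_C2 : forall l, C2_on01 (psi l);
  param_first : forall l, psi l 0 = tensor (edge l).1;
  param_second : forall l, psi l 1 = tensor (edge l).2;
  param_inj : forall l l' x y, x \in `]0, 1[ -> y \in `]0, 1[ ->
    psi l x = psi l' y -> l = l' /\ x = y
}.

Definition Gset (R : realType) (NE : nat) (psi : 'I_NE -> R -> symC R) :
  set (symC R) := \bigcup_(l in [set: 'I_NE]) (psi l @` `[0, 1]).

Definition Bset (R : realType) (NE K : nat) (psi : 'I_NE -> R -> symC R) :
  set (symCn R K) := [set X | forall i, Gset psi (X i)].

Definition polynomial_parametrization (R : realType) (k : nat)
    (B1 B2 : symC R) (A : 'I_k.-1 -> symC R) (g : R -> symC R) : Prop :=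
  forall d : R, d \in `[0, 1] ->
    g d = (1 - d) *: B1 + d *: B2
          + (d * (1 - d)) *: \sum_(m < k.-1) d ^+ m *: A m.

(* The inner product Re (tr (A^H B)) is only used for real matrices and for
   their liftings to polynomial matrices. *)
Definition frob (F : comNzRingType) (A B : 'M[F]_2) : F := \tr (A^T *m B).

Definition psd (R : realType) : set 'M[R]_2 :=
  [set A | A^T = A /\ forall x : 'cV[R]_2, 0 <= (x^T *m A *m x) 0 0].

Definition nsd (R : realType) : set 'M[R]_2 := [set A | psd (- A)].

Definition posdef (R : realType) (A : 'M[R]_2) : Prop :=
  A^T = A /\ forall x : 'cV[R]_2, x != 0 -> 0 < (x^T *m A *m x) 0 0.

Definition is_projection (R : realType) (C : set 'M[R]_2) (A P : 'M[R]_2) : Prop :=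
  C P /\ forall Q, C Q -> frob (A - P) (A - P) <= frob (A - Q) (A - Q).

(* D need not be open: the differential is taken in the whole space at every
   point of D and depends continuously on that point within D. *)
Definition C1_on (R : realType) (K : nat) (f : symCn R K -> R)
    (D : set (symCn R K)) : Prop :=
  (forall X, D X -> differentiable f X) /\
  forall Y : symCn R K, {within D, continuous (fun X : symCn R K => 'd f X Y)}.

Definition is_gradient (R : realType) (K : nat) (f : symCn R K -> R)
    (X : symCn R K) (G : 'I_K -> part -> 'M[R]_2) : Prop :=
  (forall i s, (G i s)^T = G i s) /\
  forall Y : symCn R K, 'd f X Y =
    \sum_(i < K) (frob (G i RePart) (mxpart RePart (Y i))
                  + frob (G i ImPart) (mxpart ImPart (Y i))).

Definition asymptotes (R : realType) (G : set (symC R))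
    (L U : 'M[complex R]_2) : Prop :=
  forall (Y : symC R) (s : part), G Y ->
    posdef (mxpart s Y - mxpart s L) /\ posdef (mxpart s U - mxpart s Y).

Section Terms.
Variable R : realType.
(* L, U, B: the parts L^s, U^s, Bbar_i^s of the asymptotes and of the expansion
   point; Gp, Gn: the projected gradient parts. *)
Implicit Types L U B Gp Gn Y : 'M[R]_2.

Definition Ccoef W B Gr : 'M[R]_2 := (W - B) *m Gr *m (W - B).

Definition fapprox (tau : R) L U B Gp Gn Y : R :=
  frob (Ccoef U B Gp + tau *: ((Y - B) *m (Y - B))) (invmx (U - Y))
  + frob (Ccoef L B Gn - tau *: ((Y - B) *m (Y - B))) (invmx (L - Y)).

(* Real matrices are lifted to constant polynomial matrices, and Y below is a
   polynomial matrix in the curve parameter. *)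
Definition liftmx (A : 'M[R]_2) : 'M[{poly R}]_2 := map_mx polyC A.

Definition polynomial_curve (k : nat) (B1 B2 : 'M[R]_2)
    (A : 'I_k.-1 -> 'M[R]_2) : 'M[{poly R}]_2 :=
  (1 - 'X) *: liftmx B1 + 'X *: liftmx B2
  + ('X * (1 - 'X)) *: \sum_(m < k.-1) 'X^m *: liftmx (A m).

Definition NL (tau : R) L B Gn (Y : 'M[{poly R}]_2) : {poly R} :=
  frob (liftmx (Ccoef L B Gn)
        - tau%:P *: ((Y - liftmx B) *m (Y - liftmx B)))
       (\adj (liftmx L - Y)).

Definition NU (tau : R) U B Gp (Y : 'M[{poly R}]_2) : {poly R} :=
  frob (liftmx (Ccoef U B Gp)
        + tau%:P *: ((Y - liftmx B) *m (Y - liftmx B)))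
       (\adj (liftmx U - Y)).

Definition denpoly (L U : part -> 'M[R]_2) (Y : part -> 'M[{poly R}]_2) :
    {poly R} :=
  \prod_(s <- [:: RePart; ImPart])
     (\det (liftmx (L s) - Y s) * \det (liftmx (U s) - Y s)).

(* The two polynomial divisions are exact. *)
Definition numpoly (tau : R) (L U B Gp Gn : part -> 'M[R]_2)
    (Y : part -> 'M[{poly R}]_2) : {poly R} :=
  \sum_(s <- [:: RePart; ImPart])
     ((NL tau (L s) (B s) (Gn s) (Y s) * denpoly L U Y)
        %/ \det (liftmx (L s) - Y s)
      + (NU tau (U s) (B s) (Gp s) (Y s) * denpoly L U Y)
        %/ \det (liftmx (U s) - Y s)).

Definition stationarity_poly (gamma : R) (p q : {poly R}) : {poly R} :=
  q * p^`() - q^`() * p + gamma%:P * (1 - 2%:R *: 'X) * q ^+ 2.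

Definition is_global_min01 (J : R -> R) (a : R) : Prop :=
  a \in `[0, 1] /\ forall x, x \in `[0, 1] -> J a <= J x.

End Terms.

(* Main.v *)
Require Import Defs.
From HB Require Import structures.
From mathcomp Require Import all_boot all_order all_algebra.
From mathcomp Require Import complex.
From mathcomp Require Import ring.
From mathcomp Require Import all_classical all_reals all_analysis.

Set Implicit Arguments.
Unset Strict Implicit.
Unset Printing Implicit Defensive.

Import Order.TTheory GRing.Theory Num.Theory.
Import numFieldNormedType.Exports.

Local Open Scope classical_set_scope.
Local Open Scope ring_scope.

(** The objective is, on [0, 1], a rational function without poles plus the
    quadratic penalty [gamma * d * (1 - d)], so its minimum is found among the
    end points and the interior critical points.

    No poles, and the formula [p / q]: the asymptote conditions make the real and
    imaginary parts of [U - psi d] and [psi d - L] positive definite, hence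
    invertible, since a kernel vector [v] would satisfy [v A v^T = 0]
    ([posdef_det_neq0]).  Each inverse can then be written [adj / det].
    Evaluation at [d] is a ring morphism from polynomials to reals, so it commutes
    with sums, products, traces, determinants and adjugates of polynomial
    matrices; evaluating the polynomial data therefore gives back the matrices
    of the objective ([fapprox_horner], [horner_numpoly]).

    The minimum: a continuous function attains its minimum over [0, 1].  An
    interior minimizer is a critical point, and the derivative of
    [p / q + gamma * d * (1 - d)] is the stationarity polynomial divided by
    [q ^+ 2] ([is_derive_penalized_ratio]), so the minimizer is a root of that
    polynomial and hence a candidate.  If the stationarity polynomial is zero,
    the objective has zero derivative on [0, 1]; it is constant, and the end
    point 0 already is a minimizer ([penalized_ratio_min]). *)

(** * Invertibility and evaluation of polynomial matrices *)

Lemma posdef_det_neq0 (R : realType) (A : 'M[R]_2) : posdef A -> \det A != 0.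
Proof.
move=> [_ Apos]; apply/det0P => -[v v0 vA].
by have := Apos v^T; rewrite trmxK vA mul0mx mxE ltxx trmx_eq0 => /(_ v0).
Qed.

Section Evaluation.
Variables (R : realType) (d : R).
Implicit Types (A B L U : 'M[R]_2) (Y : 'M[{poly R}]_2).

Definition evalmx Y : 'M[R]_2 := map_mx (horner_eval d) Y.

Lemma evalmx_lift A : evalmx (liftmx A) = A.
Proof. by apply/matrixP => i j; rewrite !mxE /horner_eval hornerC. Qed.

Lemma evalmxD Y Z : evalmx (Y + Z) = evalmx Y + evalmx Z.
Proof. exact: map_mxD. Qed.

Lemma evalmxB Y Z : evalmx (Y - Z) = evalmx Y - evalmx Z.
Proof. exact: map_mxB. Qed.

Lemma evalmxM Y Z : evalmx (Y *m Z) = evalmx Y *m evalmx Z.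
Proof. exact: map_mxM. Qed.

Lemma evalmxZ (c : {poly R}) Y : evalmx (c *: Y) = c.[d] *: evalmx Y.
Proof. exact: map_mxZ. Qed.

Lemma evalmx_sum n (Y : 'I_n -> 'M[{poly R}]_2) :
  evalmx (\sum_(m < n) Y m) = \sum_(m < n) evalmx (Y m).
Proof. by apply: (big_morph evalmx evalmxD); exact: map_mx0. Qed.

Lemma horner_det_lift A Y :
  (\det (liftmx A - Y)).[d] = \det (A - evalmx Y).
Proof. by rewrite -{2}[A]evalmx_lift -evalmxB /evalmx det_map_mx. Qed.

Lemma horner_frob Y Z : (frob Y Z).[d] = frob (evalmx Y) (evalmx Z).
Proof.
rewrite /frob /evalmx map_trmx -map_mxM.
exact: (esym (trace_map_mx (horner_eval d) _)).
Qed.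

Lemma horner_frob_adj Y A Z :
  (frob Y (\adj (liftmx A - Z))).[d] = frob (evalmx Y) (\adj (A - evalmx Z)).
Proof.
rewrite horner_frob; congr (frob _ _); rewrite -{2}[A]evalmx_lift -evalmxB.
exact: map_mx_adj.
Qed.

Lemma horner_divp (n c : {poly R}) :
  c %| n -> c.[d] != 0 -> (n %/ c).[d] = n.[d] / c.[d].
Proof. by move=> cn c0; rewrite -{2}(divpK cn) hornerM mulfK. Qed.

Lemma frob_invmx A B :
  \det B != 0 -> frob A (invmx B) = frob A (\adj B) / \det B.
Proof.
move=> B0; rewrite /invmx unitmxE unitfE B0 /frob -scalemxAr mxtraceZ.
by rewrite mulrC.
Qed.

Lemma fapprox_horner (tau : R) L U B Gp Gn Y :
  \det (L - evalmx Y) != 0 -> \det (U - evalmx Y) != 0 ->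
  fapprox tau L U B Gp Gn (evalmx Y) =
  (NL tau L B Gn Y).[d] / (\det (liftmx L - Y)).[d]
  + (NU tau U B Gp Y).[d] / (\det (liftmx U - Y)).[d].
Proof.
move=> L0 U0; rewrite /fapprox !frob_invmx // addrC /NL /NU.
rewrite !horner_frob_adj !horner_det_lift.
by rewrite !(evalmxB, evalmxZ, evalmxM) evalmxD evalmxZ evalmxM evalmxB
  !evalmx_lift hornerC.
Qed.

Lemma horner_denpoly_neq0 (L U : part -> 'M[R]_2) (Y : part -> 'M[{poly R}]_2) :
  (forall s, \det (L s - evalmx (Y s)) != 0) ->
  (forall s, \det (U s - evalmx (Y s)) != 0) ->
  (denpoly L U Y).[d] != 0.
Proof.
move=> L0 U0; rewrite /denpoly !big_cons big_nil !hornerE !horner_det_lift.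
by rewrite !mulf_neq0.
Qed.

(** Each determinant is one of the factors of the common denominator, which is
    what makes the divisions in [numpoly] exact. *)
Lemma det_dvd_denpoly (L U : part -> 'M[R]_2) (Y : part -> 'M[{poly R}]_2) s :
  (\det (liftmx (L s) - Y s) %| denpoly L U Y) &&
  (\det (liftmx (U s) - Y s) %| denpoly L U Y).
Proof.
rewrite /denpoly !big_cons big_nil mulr1.
case: s; rewrite ?(dvdp_mulr _ (dvdp_mulr _ (dvdpp _)))
  ?(dvdp_mulr _ (dvdp_mull _ (dvdpp _))) ?(dvdp_mull _ (dvdp_mulr _ (dvdpp _))) //.
by rewrite (dvdp_mull _ (dvdp_mull _ (dvdpp _))).
Qed.

Lemma horner_numpoly (tau : R) (L U B Gp Gn : part -> 'M[R]_2)
    (Y : part -> 'M[{poly R}]_2) :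
  (forall s, \det (L s - evalmx (Y s)) != 0) ->
  (forall s, \det (U s - evalmx (Y s)) != 0) ->
  (numpoly tau L U B Gp Gn Y).[d] / (denpoly L U Y).[d] =
  \sum_(s <- [:: RePart; ImPart])
    fapprox tau (L s) (U s) (B s) (Gp s) (Gn s) (evalmx (Y s)).
Proof.
move=> L0 U0; have q0 := horner_denpoly_neq0 L0 U0.
rewrite /numpoly horner_sum mulr_suml; apply: eq_bigr => s _.
rewrite fapprox_horner // hornerD.
have /andP[dL dU] := det_dvd_denpoly L U Y s.
rewrite !horner_divp ?horner_det_lift ?dvdp_mull // !hornerM mulrDl.
by rewrite !(mulrAC _ (denpoly L U Y).[d]) !divfK.
Qed.

End Evaluation.

Section Curve.
Variables (R : realType) (s : part).

Lemma mxpart0 : mxpart s (0 : 'M[complex R]_2) = 0.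
Proof. by apply: (addrI (mxpart s 0)); rewrite -mxpartD !addr0. Qed.

Lemma mxpart_sum (n : nat) (A : 'I_n -> symC R) :
  mxpart s (\sum_(m < n) A m) = \sum_(m < n) mxpart s (A m).
Proof.
apply: (big_morph (fun B : symC R => mxpart s B)) => [B C|].
  exact: mxpartD.
exact: mxpart0.
Qed.

Lemma mxpart_scale (a : R) (A : symC R) :
  mxpart s (a *: A) = a *: mxpart s A.
Proof. exact: mxpartZ. Qed.

(** Taking real or imaginary parts is linear over the reals, and the curve
    parameter is real: each part of the curve is the polynomial curve of the
    parts. *)
Lemma evalmx_polynomial_curve (k : nat) (B1 B2 : symC R)
    (A : 'I_k.-1 -> symC R) (psi : R -> symC R) (d : R) :
  polynomial_parametrization B1 B2 A psi -> d \in `[0, 1] ->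
  evalmx d (polynomial_curve (mxpart s B1) (mxpart s B2)
              (fun m => mxpart s (A m))) = mxpart s (psi d).
Proof.
move=> psiE /psiE ->; rewrite [in RHS]/= !mxpartD !mxpart_scale mxpart_sum.
rewrite /polynomial_curve !evalmxD !evalmxZ !evalmx_lift !hornerE.
congr (_ + _ *: _); rewrite evalmx_sum; apply: eq_bigr => m _.
by rewrite mxpart_scale evalmxZ evalmx_lift hornerXn.
Qed.

End Curve.

(** * Minimizing a rational function with a quadratic penalty *)

Section Minimization.
Variables (R : realType) (p q : {poly R}) (gamma : R).

Definition penalized_ratio (x : R) : R := p.[x] / q.[x] + gamma * x * (1 - x).

Lemma is_derive_penalized_ratio (x : R) : q.[x] != 0 ->
  is_derive x (1 : R) penalized_ratio
    ((stationarity_poly gamma p q).[x] / q.[x] ^+ 2).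
Proof.
move=> q0.
have -> : penalized_ratio =
    horner p * (fun y => (q.[y])^-1) + horner (gamma%:P * 'X * (1 - 'X)).
  by apply/funext => y; rewrite /penalized_ratio /= !fctE !hornerE.
have dq := is_deriveV q0 (is_derive_poly q x).
apply: is_derive_eq (is_deriveD (is_deriveM (is_derive_poly p x) dq)
  (is_derive_poly _ x)) _.
rewrite /stationarity_poly !(derivM, derivB, derivC, derivX) !hornerE /GRing.scale /=.
by field.
Qed.

Hypothesis q_neq0 : forall x, x \in `[0, 1] -> q.[x] != 0.

Let dJ (x : R) (x01 : x \in `[0, 1]) := is_derive_penalized_ratio (q_neq0 x01).

Lemma continuous_penalized_ratio (b : R) : b <= 1 ->
  {within `[0, b], continuous penalized_ratio}.
Proof.
move=> b1; apply: derivable_within_continuous => x.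
rewrite in_itv /= => /andP[x0 xb].
have x01 : x \in `[0, 1] by rewrite in_itv /= x0 (le_trans xb).
exact: (@ex_derive _ _ _ _ _ _ _ (dJ x01)).
Qed.

Lemma penalized_ratio_cst (x : R) : stationarity_poly gamma p q = 0 ->
  x \in `[0, 1] -> penalized_ratio x = penalized_ratio 0.
Proof.
move=> r0; rewrite in_itv /= => /andP[x0 x1].
have dJ0 y : y \in `]0, x[ -> is_derive y (1 : R) penalized_ratio (cst 0 y).
  rewrite in_itv /= => /andP[y0 yx].
  have y01 : y \in `[0, 1] by rewrite in_itv /= !ltW // (lt_le_trans yx).
  by apply: is_derive_eq (dJ y01) _; rewrite r0 horner0 mul0r.
have [c _] := MVT_segment x0 dJ0 (continuous_penalized_ratio x1).
by rewrite mul0r => /subr0_eq.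
Qed.

Lemma penalized_ratio_critical (c : R) : c \in `]0, 1[ ->
  (forall x, x \in `[0, 1] -> penalized_ratio c <= penalized_ratio x) ->
  root (stationarity_poly gamma p q) c.
Proof.
move=> c01 cmin; have sub := @subset_itv_oo_cc _ R 0 1.
have dJ0 : is_derive c (1 : R) penalized_ratio 0.
  apply: (derive1_at_min ler01) c01 _ => t /sub t01; last exact: cmin.
  exact: (@ex_derive _ _ _ _ _ _ _ (dJ t01)).
have := @derive_val _ _ _ _ _ _ _ (dJ (sub _ c01)).
rewrite (@derive_val _ _ _ _ _ _ _ dJ0) => /esym/eqP.
by rewrite mulf_eq0 invr_eq0 expf_eq0 /= (negPf (q_neq0 (sub _ c01))) orbF.
Qed.

Lemma penalized_ratio_min (s : seq R) (a : R) :
  (forall x, stationarity_poly gamma p q != 0 -> x \in `]0, 1[ ->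
     root (stationarity_poly gamma p q) x -> x \in s) ->
  (forall x, x \in 0 :: rcons s 1 -> penalized_ratio a <= penalized_ratio x) ->
  forall x, x \in `[0, 1] -> penalized_ratio a <= penalized_ratio x.
Proof.
move=> s_roots a_min x x01.
have [r0|r0] := eqVneq (stationarity_poly gamma p q) 0.
  by rewrite (penalized_ratio_cst r0 x01) a_min ?mem_head.
have [c c01 cmin] := EVT_min ler01 (continuous_penalized_ratio (lexx 1)).
apply: (le_trans _ (cmin _ x01)); apply: a_min.
rewrite inE mem_rcons inE; move: (c01).
rewrite in_itv /= => /andP[c_ge0 c_le1].
have [//|cn0] := eqVneq c 0; have [//|cn1] := eqVneq c 1.
have c_oo : c \in `]0, 1[.
  by rewrite in_itv /= !lt_neqAle c_ge0 c_le1 cn1 eq_sym cn0.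
by rewrite s_roots // penalized_ratio_critical.
Qed.

End Minimization.

(** * The selection procedure *)

Theorem theorem4p20 (R : realType) (V : finType) (NE K : nat)
    (edge : 'I_NE -> V * V)
    (Hcover : forall v : V, exists l, v = (edge l).1 \/ v = (edge l).2)
    (tensor : V -> symC R) (psi : 'I_NE -> R -> symC R)
    (Hpsi : parametrization edge tensor psi)
    (f : symCn R K -> R) (Hf : C1_on f (Bset psi))
    (Bbar : symCn R K) (HB : Bset psi Bbar)
    (G Gp Gn : 'I_K -> part -> 'M[R]_2)
    (HG : is_gradient f Bbar G)
    (HGp : forall i s, is_projection (@psd R) (G i s) (Gp i s))
    (HGn : forall i s, is_projection (@nsd R) (G i s) (Gn i s))
    (l0 u0 : complex R) (L U : 'M[complex R]_2)
    (HL : L = l0%:M) (HU : U = u0%:M) (HLU : asymptotes (Gset psi) L U)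
    (i : 'I_K) (l : 'I_NE) (tau gamma : R)
    (Htau : 0 <= tau) (Hgamma : 0 <= gamma)
    (k : nat) (B1 B2 : symC R) (A : 'I_k.-1 -> symC R)
    (Hpoly : polynomial_parametrization B1 B2 A (psi l)) :
  let fR := fapprox tau (mxpart RePart L) (mxpart RePart U)
              (mxpart RePart (Bbar i)) (Gp i RePart) (Gn i RePart) in
  let fI := fapprox tau (mxpart ImPart L) (mxpart ImPart U)
              (mxpart ImPart (Bbar i)) (Gp i ImPart) (Gn i ImPart) in
  let Y (s : part) :=
    polynomial_curve (mxpart s B1) (mxpart s B2) (fun m => mxpart s (A m)) in
  let q := denpoly (fun s => mxpart s L) (fun s => mxpart s U) Y in
  let p := numpoly tau (fun s => mxpart s L) (fun s => mxpart s U) (fun s => mxpart s (Bbar i))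
             (Gp i) (Gn i) Y in
  let r := stationarity_poly gamma p q in
  let J (d : R) := fR (mxpart RePart (psi l d)) + fI (mxpart ImPart (psi l d))
                   + gamma * d * (1 - d) in
  (forall d, d \in `[0, 1] ->
     q.[d] != 0 /\
     fR (mxpart RePart (psi l d)) + fI (mxpart ImPart (psi l d))
       = p.[d] / q.[d]) /\
  (forall (n : nat) (alpha : n.-tuple R)
     (Halpha : forall x, (x \in alpha) = [&& r != 0, x \in `]0, 1[ & root r x])
     (nstar : 'I_n.+2),
     let beta : n.+2.-tuple R := [tuple of 0 :: rcons alpha 1] in
     (forall m : 'I_n.+2, J (tnth beta nstar) <= J (tnth beta m)) ->
     is_global_min01 J (tnth beta nstar)).
Proof.
move=> fR fI Y q p r J.
have part_det d s : d \in `[0, 1] ->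
    \det (mxpart s L - evalmx d (Y s)) != 0 /\
    \det (mxpart s U - evalmx d (Y s)) != 0.
  move=> d01; rewrite (evalmx_polynomial_curve s Hpoly d01).
  have [|pL pU] := HLU (psi l d) s; first by exists l => //; exists d.
  split; last exact: posdef_det_neq0.
  (* L - Y is negative definite, but in even dimension its determinant is that
     of Y - L. *)
  rewrite -opprB -scaleN1r detZ sqrrN expr1n mul1r.
  exact: posdef_det_neq0.
have ratioE d : d \in `[0, 1] ->
    q.[d] != 0 /\
    fR (mxpart RePart (psi l d)) + fI (mxpart ImPart (psi l d))
      = p.[d] / q.[d].
  move=> d01.
  have detL s := proj1 (part_det d s d01).
  have detU s := proj2 (part_det d s d01).
  split; first exact: horner_denpoly_neq0.
  by rewrite horner_numpoly // !big_cons big_nil addr0 !(evalmx_polynomial_curve _ Hpoly d01).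
split=> // n alpha alphaE nstar beta nstar_min.
have JE d : d \in `[0, 1] -> J d = penalized_ratio p q gamma d.
  by move=> /ratioE [_ fE]; rewrite /J fE.
have beta01 x : x \in beta -> x \in `[0, 1].
  rewrite inE mem_rcons inE => /or3P[/eqP ->|/eqP ->|].
  - by rewrite in_itv /= lexx ler01.
  - by rewrite in_itv /= ler01 lexx.
  - by rewrite alphaE => /and3P[_ /subset_itv_oo_cc].
have nstar01 := beta01 _ (mem_tnth nstar beta).
split=> // x x01; rewrite !JE //.
apply: (@penalized_ratio_min _ p q gamma _ alpha) => // [y /ratioE[] //||y].
  by move=> y r0 y01 ry; rewrite alphaE; apply/and3P.
move=> y_beta; have /tnthP[m ym] : y \in beta by [].
have y01 := beta01 y y_beta.
by rewrite -!JE // ym.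
Qed.
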